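(* Let $N$ be an even perfect number with $N \neq 6$. Then $N$ can be written as the sum of $5$ cubes of natural numbers, i.e., there exist natural numbers $x_1, x_2, x_3, x_4, x_5$ (where $0$ is allowed) such that $N = x_1^3 + x_2^3 + x_3^3 + x_4^3 + x_5^3$.
   Context: A perfect number is a positive integer that is equal to the sum of its proper positive divisors (the positive divisors other than the number itself). The natural numbers are $\mathbb{N} = \{0, 1, 2, \dots\}$; in particular $0$ is a natural number, and the $x_i$ need not be distinct. *)

(* Defs.v *)
(* MathComp *)
From mathcomp Require Import all_boot.

Set Implicit Arguments.
Unset Strict Implicit.
Unset Printing Implicit Defensive.

(* Positivity is not redundant: the sum is empty, hence equal to 0, at n = 0. *)
Definition perfect_number (n : nat) : Prop :=
  0 < n /\ \sum_(1 <= d < n | d %| n) d = n.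

(* Main.v *)
(* By the Euclid-Euler theorem N = 2 ^ (p - 1) * (2 ^ p - 1) with 2 ^ p - 1
   prime, and for N <> 6 either N = 28 or p is congruent to 1 or 5 modulo 6.
   Put u = 2 ^ k.  The identity
     (u^2 + u - 1)^3 + (u^2 - u - 1)^3 = 2 u^6 - 2
   settles both classes: for p = 6 k + 1 it gives
     N = (u^2)^3 (2 u^6 - 1) with 2 u^6 - 1 = (2 u^6 - 2) + 1^3,
   and for p = 6 k + 5, since 62 = 2^3 + 3^3 + 3^3,
     N = (2 u^2)^3 (64 u^6 - 2) with 64 u^6 - 2 = (2 u^6 - 2) + 62 u^6.
   The bases are natural numbers only for u >= 2; the remaining exponent p = 5
   is 496 = 4^3 + 6^3 + 6^3. *)
Require Import Defs.
From mathcomp Require Import all_boot.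
From mathcomp Require Import zify ring.

Lemma perfect_sum_divisors (n : nat) :
  perfect_number n -> \sum_(d <- divisors n) d = n.*2.
Proof.
case=> n_gt0 sum_n.
(* Extending the range by one admits the divisor [n] itself, which doubles the sum. *)
have divE : perm_eq (divisors n) [seq d <- index_iota 1 n.+1 | d %| n].
  apply: uniq_perm; rewrite ?divisors_uniq ?filter_uniq ?iota_uniq // => d.
  rewrite -dvdn_divisors // mem_filter mem_index_iota ltnS.
  by case: (boolP (d %| n)) => //= dn; rewrite (dvdn_gt0 n_gt0 dn) dvdn_leq.
by rewrite (perm_big _ divE) big_filter big_mkcond big_nat_recr //= dvdnn
           -big_mkcond /= sum_n addnn.
Qed.

(** The 2-adic valuation of [2 ^ i * d] with [d] odd is [i], so the products are distinct;
    conversely a divisor splits into a power of 2 and an odd part, which is coprime to [2 ^ a] and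
    hence divides [m]. *)
Lemma divisors_pow2_mul (a m : nat) : odd m ->
  perm_eq (divisors (2 ^ a * m))
          [seq 2 ^ i * d | i <- iota 0 a.+1, d <- divisors m].
Proof.
move=> m_odd; have m_gt0 : 0 < m by case: m m_odd.
have odd_div d : d \in divisors m -> odd d.
  by rewrite -dvdn_divisors // => /dvdn_odd; apply.
have logn_div i d : odd d -> logn 2 (2 ^ i * d) = i.
  move=> d_odd; have d_gt0 : 0 < d by case: d d_odd.
  by rewrite lognM ?expn_gt0 // pfactorK // logn_coprime ?addn0 // coprime2n.
apply: uniq_perm; first exact: divisors_uniq.
  apply: allpairs_uniq; rewrite ?iota_uniq ?divisors_uniq //.
  move=> [i d] [j e] /allpairsP[p [_ /odd_div d_odd [-> ->]]].
  move=> /allpairsP[r [_ /odd_div e_odd [-> ->]]] /= eq_ij.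
  have eij : p.1 = r.1 by rewrite -(logn_div p.1 _ d_odd) eq_ij logn_div.
  by move: eq_ij; rewrite eij => /eqP; rewrite eqn_pmul2l ?expn_gt0 // => /eqP->.
move=> d; rewrite -dvdn_divisors ?muln_gt0 ?expn_gt0 //.
apply/idP/allpairsP => [dvd_d | [[i e] []]]; last first.
  rewrite mem_iota ltnS -dvdn_divisors // => /= le_ia dvd_e ->.
  by rewrite dvdn_mul // dvdn_exp2l.
have d_gt0 : 0 < d by apply: dvdn_gt0 dvd_d; rewrite muln_gt0 expn_gt0.
have [e e_odd dE] := pfactor_coprime (isT : prime 2) d_gt0.
exists (logn 2 d, e); rewrite mem_iota ltnS -dvdn_divisors //; split=> /=.
- rewrite -[leqRHS](logn_div a m m_odd).
  by apply: dvdn_leq_log => //; rewrite muln_gt0 expn_gt0.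
- have : e %| 2 ^ a * m by apply: dvdn_trans dvd_d; rewrite dE dvdn_mulr.
  by rewrite Gauss_dvdr // coprimeXr // coprime_sym.
- by rewrite mulnC.
Qed.

Lemma sum_divisors_pow2_mul (a m : nat) : odd m ->
  \sum_(d <- divisors (2 ^ a * m)) d =
  (2 ^ a.+1).-1 * \sum_(d <- divisors m) d.
Proof.
move=> m_odd; rewrite (perm_big _ (divisors_pow2_mul a m m_odd)) big_allpairs_dep.
have geo : \sum_(i <- iota 0 a.+1) 2 ^ i = (2 ^ a.+1).-1.
  rewrite predn_exp mul1n -(big_mkord xpredT (fun i => 2 ^ i)).
  by rewrite /index_iota subn0.
rewrite -geo big_distrl; apply: eq_bigr => i _.
by rewrite big_distrr.
Qed.

(** The distinct divisors [m] and [k] already exhaust the sum, so a third one, being positive, would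
    exceed it. As 1 is a divisor, [k] must be 1. *)
Lemma prime_of_sum_divisors (m k : nat) : 0 < k -> k < m -> k %| m ->
  \sum_(d <- divisors m) d = m + k -> prime m.
Proof.
move=> k_gt0 lt_km dvd_k sum_m.
have m_gt0 : 0 < m by exact: leq_trans lt_km.
have m_div : m \in divisors m by rewrite -dvdn_divisors.
have k_div : k \in rem m (divisors m).
  by rewrite mem_rem_uniq ?divisors_uniq // inE -dvdn_divisors // dvd_k neq_ltn lt_km.
move/eqP: sum_m; rewrite (big_rem m) //= (big_rem k) //= addnA.
rewrite -[X in _ == X]addn0 eqn_add2l => /eqP sum_m.
have only d : d %| m -> (d == m) || (d == k).
  move=> dvd_d; apply/norP => -[ne_dm ne_dk].
  have d_in : d \in rem k (rem m (divisors m)).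
    rewrite mem_rem_uniq ?rem_uniq ?divisors_uniq // inE ne_dk /=.
    by rewrite mem_rem_uniq ?divisors_uniq // inE ne_dm -dvdn_divisors.
  move/eqP: sum_m; rewrite (big_rem d) //= addn_eq0 => /andP[/eqP d0 _].
  by move: (dvdn_gt0 m_gt0 dvd_d); rewrite d0.
have k1 : k = 1.
  have /orP[/eqP m1 | /eqP //] := only 1 (dvd1n _).
  by move: lt_km; rewrite -m1 ltnS leqNgt k_gt0.
apply/primeP; split; first by rewrite -k1.
by move=> d /only; rewrite k1 orbC.
Qed.

(** Write [n = 2 ^ a * m] with [m] odd and [q = 2 ^ a.+1 - 1]. The divisor sum of [m], times [q], is
    [q.+1 * m]; as [q] is coprime to [q.+1], [m = k * q] and the divisor sum of [m] is [m + k]. *)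
Theorem euclid_euler (n : nat) : perfect_number n -> ~~ odd n ->
  exists2 p, prime (2 ^ p).-1 & n = 2 ^ p.-1 * (2 ^ p).-1.
Proof.
move=> n_perf n_even; have [n_gt0 _] := n_perf.
have := perfect_sum_divisors n n_perf.
have [m m_cop nE] := pfactor_coprime (isT : prime 2) n_gt0.
have m_odd : odd m by rewrite -coprime2n.
have a_gt0 : 0 < logn 2 n by rewrite logn_gt0 mem_primes n_gt0 dvdn2 n_even.
move: (logn 2 n) nE a_gt0 => a nE a_gt0.
rewrite mulnC in nE; rewrite {1}nE sum_divisors_pow2_mul // => sum_m.
have pow_ge4 : 4 <= 2 ^ a.+1 by rewrite -[4]/(2 ^ 2) leq_exp2l.
set q := (2 ^ a.+1).-1 in sum_m.
have qE : 2 ^ a.+1 = q.+1 by rewrite /q prednK // expn_gt0.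
have {}sum_m : q * (\sum_(d <- divisors m) d) = q.+1 * m.
  by rewrite sum_m -qE nE expnS -mul2n mulnA.
have : q %| m.
  have : q %| q.+1 * m by rewrite -sum_m dvdn_mulr.
  by rewrite Gauss_dvdr // coprimenS.
case/dvdnP=> k mE.
have m_gt0 : 0 < m by case: m m_odd {m_cop nE sum_m mE}.
have sum_mk : \sum_(d <- divisors m) d = m + k.
  apply/eqP; rewrite -(eqn_pmul2l (_ : 0 < q)); last by lia.
  by apply/eqP; rewrite sum_m mE; ring.
have m_pr : prime m.
  apply: (prime_of_sum_divisors m k) sum_mk; first by nia.
    by nia.
  by rewrite mE dvdn_mulr.
(* Since [a > 0], [q] is at least 3, so it is a nontrivial divisor of the prime [m]. *)
have q_m : q = m.
  have /(prime_nt_dvdP m_pr) : q %| m by rewrite mE dvdn_mull.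
  by apply; apply/eqP; lia.
by exists a.+1; rewrite -/q q_m.
Qed.

(** If [d] divides [p], then [2 ^ d - 1] divides [2 ^ p - 1], and it is not 1 because [d > 1];
    primality forces equality. *)
Lemma mersenne_prime_exponent (p d : nat) : 1 < d -> d %| p ->
  prime (2 ^ p).-1 -> p = d.
Proof.
move=> d_gt1 /dvdnP[c ->] pr.
have dvd : (2 ^ d).-1 %| (2 ^ (c * d)).-1.
  by rewrite mulnC expnM [X in _ %| X]predn_exp dvdn_mulr.
have ge4 : 4 <= 2 ^ d by rewrite -[4]/(2 ^ 2) leq_exp2l.
have /(prime_nt_dvdP pr) eq_pow := dvd.
have {}eq_pow : (2 ^ d).-1 = (2 ^ (c * d)).-1 by apply: eq_pow; apply/eqP; lia.
have gt0 : 0 < 2 ^ (c * d) by rewrite expn_gt0.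
by apply/eqP; rewrite -(eqn_exp2l _ _ (isT : 1 < 2)); apply/eqP; lia.
Qed.

Lemma two_cubes (u : nat) : 1 < u ->
  exists x y, x ^ 3 + y ^ 3 + 2 = 2 * u ^ 6.
Proof.
case: u => [|[|v]] // _.
(* These are [u ^ 2 + u - 1] and [u ^ 2 - u - 1] at [u = v + 2], expanded to avoid truncated
   subtraction. *)
by exists (v ^ 2 + 5 * v + 5), (v ^ 2 + 3 * v + 1); ring.
Qed.

Theorem theorem1 (N : nat) (hperf : perfect_number N) (heven : ~~ odd N)
    (hN6 : N <> 6) :
  exists x1 x2 x3 x4 x5 : nat,
    N = x1 ^ 3 + x2 ^ 3 + x3 ^ 3 + x4 ^ 3 + x5 ^ 3.
Proof.
have [p pr NE] := euclid_euler N hperf heven.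
(* An even [p] must be 2, giving the excluded 6; a multiple of 3 must be 3, giving 28 = 1^3 +
   3^3. *)
have [p2 | p_odd] := boolP (2 %| p).
  by case: hN6; rewrite NE (mersenne_prime_exponent p 2 isT p2 pr).
have [p3 | p_n3] := boolP (3 %| p).
  by rewrite NE (mersenne_prime_exponent p 3 isT p3 pr); exists 1, 3, 0, 0, 0.
have [k [pE|pE]] : exists k, p = 6 * k + 1 \/ p = 6 * k + 5.
  by exists (p %/ 6); lia.
(* For [k = 0] the exponent is 1, and 2^1 - 1 = 1 is not prime. *)
- have k_gt0 : 0 < k by case: k pE pr => // ->.
  have [x [y xyE]] : exists x y, x ^ 3 + y ^ 3 + 2 = 2 * (2 ^ k) ^ 6.
    by apply: two_cubes; rewrite -[1]/(2 ^ 0) ltn_exp2l.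
  move: NE; rewrite pE addn1 /= expnS [6 * k]mulnC expnM.
  set u := 2 ^ k in xyE * => NE.
  exists (u ^ 2 * x), (u ^ 2 * y), (u ^ 2), 0, 0; rewrite NE.
  by rewrite (_ : (2 * u ^ 6).-1 = x ^ 3 + y ^ 3 + 1); [ring | lia].
- have [k0 | k_gt0] := posnP k.
    by rewrite NE pE k0; exists 4, 6, 6, 0, 0.
  have [x [y xyE]] : exists x y, x ^ 3 + y ^ 3 + 2 = 2 * (2 ^ k) ^ 6.
    by apply: two_cubes; rewrite -[1]/(2 ^ 0) ltn_exp2l.
  have {}NE : N = 2 ^ (6 * k + 4) * (2 ^ (6 * k + 5)).-1 by rewrite NE pE addnS.
  move: NE; rewrite [6 * k]mulnC !expnD expnM.
  set u := 2 ^ k in xyE * => NE.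
  (* Moving a factor 2 out of [16 * u ^ 6] leaves the cube [8 * u ^ 6] and doubles the Mersenne
     factor to [64 * u ^ 6 - 2]. *)
  have cE : (u ^ 6 * 2 ^ 5).-1.*2 = x ^ 3 + y ^ 3 + 62 * u ^ 6 by lia.
  exists (2 * u ^ 2 * x), (2 * u ^ 2 * y), (2 * u ^ 2 * (3 * u ^ 2)),
    (2 * u ^ 2 * (3 * u ^ 2)), (2 * u ^ 2 * (2 * u ^ 2)).
  transitivity (8 * u ^ 6 * (u ^ 6 * 2 ^ 5).-1.*2); last by rewrite cE; ring.
  by rewrite NE -mul2n; ring.
Qed.
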